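(* Let $M$ be a matroid with ground set $E$, let $\psi\colon E\to\Gamma$ be a map to an abelian group $\Gamma$, and let $F\subseteq\Gamma$ be a finite set with $|F|\le 4$. Suppose $M$ has at least one $F$-avoiding basis. Then for every basis $A$ of $M$ there exists an $F$-avoiding basis $B$ of $M$ with $|A\setminus B|\le |F|$.
   Context: For $X\subseteq E$, $\psi(X)\coloneqq\sum_{e\in X}\psi(e)$; $X$ is $F$-avoiding if $\psi(X)\notin F$. *)

(* Defs.v *)
From mathcomp Require Export all_boot all_algebra finmap.

Set Implicit Arguments.
Unset Strict Implicit.
Unset Printing Implicit Defensive.

Record matroid (E : finType) := Matroid {
  indep : pred {set E};
  indep0 : indep set0;
  indepS : forall I J : {set E}, I \subset J -> indep J -> indep I;
  indep_aug : forall I J : {set E}, indep I -> indep J -> #|I| < #|J| ->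
    exists2 e : E, e \in J :\: I & indep (e |: I)
}.

Definition basis (E : finType) (M : matroid E) (B : {set E}) : bool :=
  maxset (indep M) B.

Definition label_sum (E : finType) (Gamma : zmodType) (psi : E -> Gamma)
  (X : {set E}) : Gamma := (\sum_(e in X) psi e)%R.

Definition avoiding (E : finType) (Gamma : zmodType) (psi : E -> Gamma)
  (F : {fset Gamma}) (X : {set E}) : bool := label_sum psi X \notin F.

(* Main.v *)
(** Choose an avoiding basis [B] with [d = #|A :\: B|] minimal and put
    [C = A :&: B].  By minimality, [B] is the only basis between [C] and
    [A :|: B] whose label lies outside [F]; we show that these bases have at
    least [d + 1] labels, whence [d <= #|F|].

    Let [U g] be the set of elements of [A :|: B] outside [C] with label [g].
    No element of [A :\: B] can replace an element of [B :\: A] with the same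
    label, so [C :|: U g] is independent and, in [M / C], the ranks of the [U g]
    add up to [2 d].  Now contract the elements [e] of [B :\: A] one at a time.
    If [e] is spanned by [U g] in the current contraction, then [e] can be
    replaced by an element of label [g] in every basis containing it; so the
    labels contain the sum of the sets [W_e] of labels [g] spanning [e], and
    [sum_e #|W_e| = 2 d] since each contraction lowers the rank of exactly the
    spanning [U g].  Because the label of [B] is attained by [B] only, it has a
    unique representation in this sum, and Scherk's theorem
    [#|X + Y| >= #|X| + #|Y| - 1] yields [2 d - (d - 1)] labels. *)

Require Import Defs.
From mathcomp Require Import zify.

Set Implicit Arguments.
Unset Strict Implicit.
Unset Printing Implicit Defensive.

Local Open Scope fset_scope.

(** * Scherk's theorem by Dyson's transform *)

Section Scherk.

Variable Gamma : zmodType.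
Implicit Types X Y : {fset Gamma}.

Import GRing.Theory.
Local Open Scope ring_scope.

Definition sumset X Y : {fset Gamma} := [fset x + y | x in X, y in Y].

Lemma sumsetP X Y z :
  reflect (exists x y, [/\ x \in X, y \in Y & z = x + y]) (z \in sumset X Y).
Proof.
apply: (iffP (imfset2P _ _ _ _ _)) => [[x xX [y yY ->]]|[x [y [xX yY ->]]]].
  by exists x, y.
by exists x => //; exists y.
Qed.

(** Induction on the size of [Y]: Dyson's transform keeps the total size of the pair, does not
    enlarge the sumset and preserves the unique representation of 0, while [Y] shrinks. *)
Lemma Scherk X Y : 0 \in X -> 0 \in Y ->
    (forall x y, x \in X -> y \in Y -> x + y = 0 -> y = 0) ->
  (#|` X| + #|` Y| <= #|` sumset X Y|.+1)%N.
Proof.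
move: {2}#|` Y| (leqnn #|` Y|) => n; elim: n X Y => [|n IHn] X Y.
  by rewrite leqn0 cardfs_eq0 => /eqP-> _; rewrite inE.
move=> leYn X0 Y0 uniq0.
have [Y1|/fset0Pn[b]] := eqVneq (Y `\ 0) fset0.
  have subXS : X `<=` sumset X Y.
    by apply/fsubsetP=> x xX; apply/sumsetP; exists x, 0; rewrite addr0.
  have := cardfsD1 0 Y; rewrite Y0 Y1 cardfs0 addn0 => ->.
  by rewrite addn1 ltnS fsubset_leq_card.
rewrite !inE => /andP[b0 bY].
have [a aX [c cY acX]] : exists2 a, a \in X & exists2 c, c \in Y & a + c \notin X.
  have [/hasP[a aX /hasP[c cY ac]]|noac] :=
    boolP (has (fun a => has (fun c => a + c \notin X) Y) X).
    by exists a => //; exists c.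
  have stabX x y : x \in X -> y \in Y -> x + y \in X.
    move=> xX yY; apply: contraR noac => xyX.
    by apply/hasP; exists x => //; apply/hasP; exists y.
  (* If [X] absorbs [Y], translation by [b] permutes [X], so 0 equals some [x + b] with [b]
     nonzero. *)
  have imX : [fset x + b | x in X] = X.
    apply/eqP; rewrite eqEfcard; apply/andP; split.
      by apply/fsubsetP=> _ /imfsetP[x /= xX ->]; exact: stabX.
    by rewrite card_imfset //; exact: addIr.
  have : 0 \in [fset x + b | x in X] by rewrite imX.
  case/imfsetP=> x /= xX /esym xb0.
  by rewrite (uniq0 x b xX bY xb0) eqxx in b0.
(* Dyson's transform: the elements of [Y] not translated into [X] by [a] are
   moved, after translation, to [X]. *)
pose Y1 := [fset y in Y | a + y \in X].
pose Y2 := [fset y in Y | a + y \notin X].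
pose X1 := X `|` [fset a + y | y in Y2].
have cardY : #|` Y| = (#|` Y1| + #|` Y2|)%N.
  rewrite -cardfsUI.
  have -> : Y1 `&` Y2 = fset0.
    by apply/fsetP=> y; rewrite !inE /=; case: (y \in Y); case: (_ \in X).
  rewrite cardfs0 addn0; congr #|` _|.
  by apply/fsetP=> y; rewrite !inE /=; case: (y \in Y); case: (_ \in X).
have cardX1 : #|` X1| = (#|` X| + #|` Y2|)%N.
  have <- : #|` [fset a + y | y in Y2]| = #|` Y2|.
    by rewrite card_imfset //; exact: addrI.
  rewrite -cardfsUI.
  suff -> : X `&` [fset a + y | y in Y2] = fset0 by rewrite cardfs0 addn0.
  apply/eqP; rewrite -fsubset0; apply/fsubsetP=> z; rewrite inE => /andP[zX].
  by case/imfsetP=> y /=; rewrite !inE /= => /andP[_ /negP ayX] E; rewrite E in zX.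
have Y2gt0 : (0 < #|` Y2|)%N.
  by rewrite cardfs_gt0; apply/fset0Pn; exists c; rewrite !inE /= cY.
(* A new element [a + y'] of [X1] plus [y] in [Y1] regroups as [(a + y) + y'], where [a + y] is in
   [X]. *)
have subS : sumset X1 Y1 `<=` sumset X Y.
  apply/fsubsetP=> z /sumsetP[x [y [+ + ->]]].
  rewrite !inE /= => + /andP[yY ayX].
  case/orP=> [xX|/imfsetP[y' /=]]; first by apply/sumsetP; exists x, y.
  rewrite !inE /= => /andP[y'Y _] ->.
  by apply/sumsetP; exists (a + y), y'; rewrite addrAC.
rewrite cardY (addnC #|` Y1|) addnA -cardX1.
apply: leq_trans (_ : #|` sumset X1 Y1|.+1 <= _)%N; last first.
  by rewrite ltnS fsubset_leq_card.
apply: IHn.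
- by rewrite -ltnS; apply: leq_trans leYn; rewrite cardY -addn1 leq_add2l.
- by rewrite !inE X0.
- by rewrite !inE /= Y0 addr0.
move=> x y; rewrite !inE /= => + /andP[yY ayX].
case/orP=> [xX|/imfsetP[y' /=]]; first exact: uniq0.
rewrite !inE /= => /andP[y'Y ay'X] -> xy0.
have y'0 : y' = 0 by apply: (uniq0 (a + y)) => //; rewrite addrAC.
by move: ay'X; rewrite y'0 addr0 aX.
Qed.

End Scherk.

Local Close Scope fset_scope.

(** * Rank, basis extension and exchange *)

Section Rank.

Variables (E : finType) (M : matroid E).
Implicit Types (I X Y T B P U : {set E}) (e c : E).

Definition rank X := \max_(I : {set E} | (I \subset X) && indep M I) #|I|.

Lemma leq_rank I X : I \subset X -> indep M I -> #|I| <= rank X.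
Proof. by move=> IX indI; apply: leq_bigmax_cond; rewrite IX. Qed.

Lemma rank_witness X : exists I, [/\ I \subset X, indep M I & #|I| = rank X].
Proof.
pose A := [pred J : {set E} | (J \subset X) && indep M J].
have [|I /andP[IX indI] eqI] := @eq_bigmax_cond _ A (fun J => #|J|).
  by apply/card_gt0P; exists set0; rewrite inE sub0set indep0.
by exists I; split=> //; rewrite -eqI.
Qed.

Lemma rank_indep X : indep M X -> rank X = #|X|.
Proof.
move=> indX; apply/eqP; rewrite eqn_leq leq_rank // andbT.
by apply/bigmax_leqP=> I /andP[IX _]; exact: subset_leq_card.
Qed.

Lemma rankS X Y : X \subset Y -> rank X <= rank Y.
Proof.
have [I [IX indI <-]] := rank_witness X => XY.
by apply: leq_rank => //; exact: subset_trans XY.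
Qed.

Lemma rankU1_leq e X : rank (e |: X) <= (rank X).+1.
Proof.
have [I [IX indI <-]] := rank_witness (e |: X).
have leI : #|I :\ e| <= rank X.
  by apply: leq_rank (indepS (subD1set I e) indI); rewrite subDset.
by rewrite (cardsD1 e) -add1n leq_add ?leq_b1.
Qed.

Lemma rankU1 e X : rank (e |: X) + (rank (e |: X) == rank X) = (rank X).+1.
Proof.
have := rankS (subsetUr [set e] X); have := rankU1_leq e X.
by case: eqVneq; lia.
Qed.

Lemma basis_indep B : basis M B -> indep M B. Proof. exact: maxsetp. Qed.

Lemma basis_card_max B I : basis M B -> indep M I -> #|I| <= #|B|.
Proof.
move=> bB indI; rewrite leqNgt; apply/negP.
case/(indep_aug (basis_indep bB) indI)=> e; rewrite inE => /andP[eB _] ind_eB.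
by move: eB; rewrite -(maxsetsup bB ind_eB (subsetUr _ _)) !inE eqxx.
Qed.

Lemma card_basis B T : basis M B -> basis M T -> #|T| = #|B|.
Proof.
by move=> bB bT; apply/eqP; rewrite eqn_leq !basis_card_max // basis_indep.
Qed.

Lemma indep_basis B I : basis M B -> indep M I -> #|I| = #|B| -> basis M I.
Proof.
move=> bB indI cI; apply/maxsetP; split=> // J indJ IJ.
by apply/esym/eqP; rewrite eqEcard IJ cI basis_card_max.
Qed.

Lemma extend_basis B I : basis M B -> indep M I ->
  exists T, [/\ basis M T, I \subset T & T \subset I :|: B].
Proof.
move=> bB indI.
have [|T maxT IT] := @maxset_exists _ (fun T => indep M T && (T \subset I :|: B)) I.
  by rewrite indI subsetUl.
have /andP[indT TIB] := maxsetp maxT; exists T; split=> //.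
apply: (indep_basis bB) => //; apply/eqP; rewrite eqn_leq basis_card_max //=.
rewrite leqNgt; apply/negP => /(indep_aug indT (basis_indep bB))[e].
rewrite inE => /andP[eT eB] ind_eT; case/negP: eT.
rewrite -(maxsetsup maxT _ (subsetUr [set e] T)) ?setU11 //.
by rewrite ind_eT subUset TIB sub1set inE eB orbT.
Qed.

Lemma basis_swap T e c : basis M T -> e \in T -> c \notin T :\ e ->
  indep M (c |: T :\ e) -> basis M (c |: T :\ e).
Proof.
move=> bT eT cT indc; apply: (indep_basis bT) => //.
by rewrite cardsU1 cT (cardsD1 e T) eT.
Qed.

(** Here [U] spans [e] after contracting [P]. If [e] is not in [U], extend a maximal independent
    subset of [P :|: U] by elements of [T]: the resulting basis misses [e], and augmenting [T :\ e]
    from it gives an element outside [T], hence in [U]. *)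
Lemma basis_exchange_span T P U e : basis M T -> e |: P \subset T -> e \notin P ->
    rank (e |: (P :|: U)) = rank (P :|: U) ->
  exists c, [/\ c \in U, c \notin T :\ e & basis M (c |: T :\ e)].
Proof.
move=> bT; rewrite subUset sub1set => /andP[eT PT] eP rk_eq.
have [eU|eU] := boolP (e \in U).
  by exists e; rewrite setD1K // !inE eqxx.
have [I [IX indI cI]] := rank_witness (P :|: U).
have [I' [bI' II' I'IT]] := extend_basis bT indI.
have eI' : e \notin I'.
  apply/negP=> eI'; have eI : e \notin I.
    by apply: contra eP => /(subsetP IX); rewrite inE (negPf eU) orbF.
  have : #|e |: I| <= rank (e |: (P :|: U)).
    apply: leq_rank; first exact: setUS.
    by apply: indepS (basis_indep bI'); rewrite subUset sub1set eI'.
  by rewrite rk_eq -cI cardsU1 eI ltnn.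
have [|c] := indep_aug (indepS (subD1set T e) (basis_indep bT)) (basis_indep bI').
  by rewrite (card_basis bT bI') [X in _ < X](cardsD1 e) eT.
rewrite inE => /andP[cT cI'] indc; exists c; split=> //; last exact: basis_swap.
have ce : c != e by apply: contraNneq eI' => <-.
have : c \in I :|: T by apply: subsetP cI'.
have /negPf cT' : c \notin T by move: cT; rewrite !inE ce.
rewrite inE cT' orbF => /(subsetP IX); rewrite inE => /orP[|//].
by move/(subsetP PT); rewrite cT'.
Qed.

End Rank.

Lemma leq_sum_card_fset (K : choiceType) (G : {fset K}) (p : pred K) :
  \sum_(g <- G) p g <= #|` [fset g in G | p g]%fset|.
Proof.
rewrite -big_mkcond /= sum1_count -size_filter; apply: uniq_leq_size.
  by rewrite filter_uniq ?fset_uniq.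
by move=> g; rewrite mem_filter !inE /= andbC.
Qed.

(** * Counting labels around a basis with a unique label *)

Section Isolated.

Variables (E : finType) (M : matroid E) (Gamma : zmodType) (psi : E -> Gamma).
Variables A B : {set E}.
Implicit Types P T : {set E}.
Hypotheses (bA : basis M A) (bB : basis M B).
Hypothesis isolated : forall T, basis M T -> A :&: B \subset T ->
  T \subset A :|: B -> label_sum psi T = label_sum psi B -> T = B.

Import GRing.Theory.

Let U g := [set x in (A :|: B) :\: (A :&: B) | psi x == g].
Let G : {fset Gamma} := [fset g in codom psi]%fset.

(** The shift moves the label of [B] to 0, as [Scherk] requires. *)
Definition shifted_labels (P : {set E}) : {fset Gamma} :=
  [fset (label_sum psi T - label_sum psi B)%R
     | T in [set T | [&& basis M T, P \subset T & T \subset A :|: B]]]%fset.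

Lemma shifted_labelsP P x :
  reflect (exists T, [/\ basis M T, P \subset T, T \subset A :|: B &
                        x = label_sum psi T - label_sum psi B]%R)
          (x \in shifted_labels P).
Proof.
apply: (iffP (imfsetP _ _ _ _)) => /= [[T]|[T [bT PT TAB ->]]].
  by rewrite inE => /and3P[bT PT TAB] ->; exists T.
by exists T => //; rewrite inE bT PT TAB.
Qed.

Lemma label_sum_swap T e c : e \in T -> c \notin T :\ e ->
  (label_sum psi (c |: T :\ e) = label_sum psi T + (psi c - psi e))%R.
Proof.
move=> eT cT; rewrite /label_sum big_setU1 //= (big_setD1 e eT) /=.
by rewrite addrC -addrA addrCA; congr (_ + _)%R; rewrite addrCA subrr addr0.
Qed.

(** Extend the part of the set inside [A] by elements of [B]. If some [b] of [U g] were missed,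
    augmenting [B :\ b] would bring in an element of [A :\: B] with the same label [g],
    contradicting [isolated]. *)
Lemma indep_color_class g : indep M (A :&: B :|: U g).
Proof.
have indI : indep M (A :&: B :|: (U g :&: A)).
  by apply: indepS (basis_indep bA); rewrite subUset subsetIl subsetIr.
have [T [bT IT TIB]] := extend_basis bB indI.
apply: indepS (basis_indep bT); rewrite subUset (subset_trans (subsetUl _ _) IT) /=.
apply/subsetP=> b bU; have [bA'|bA'] := boolP (b \in A).
  by apply: (subsetP IT); rewrite inE [X in _ || X]inE bU bA' orbT.
have bB' : b \in B by move: bU; rewrite !inE (negPf bA') => /andP[].
apply: contraT => bT'.
have [|c] := indep_aug (indepS (subD1set B b) (basis_indep bB)) (basis_indep bT).
  by rewrite (card_basis bB bT) [X in _ < X](cardsD1 b) bB'.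
rewrite inE => /andP[cB cT] indc.
have cb : c != b by apply: contraNneq bT' => <-.
have cB' : c \notin B by move: cB; rewrite !inE cb.
have cU : (c \in A) && (c \in U g).
  move/(subsetP TIB): cT; rewrite inE (negPf cB') orbF inE => /orP[].
    by rewrite inE (negPf cB') andbF.
  by rewrite inE andbC.
have /andP[cA] := cU; rewrite inE => /andP[_ /eqP psi_c].
have eqB : c |: B :\ b = B.
  apply: isolated; first exact: basis_swap.
  - apply/subsetP=> x; rewrite !inE => /andP[xA xB]; rewrite xB.
    by have -> : x != b by [apply: contraNneq bA' => <-]; rewrite orbT.
  - apply/subsetP=> x; rewrite !inE => /orP[/eqP->|/andP[_ ->]].
      by rewrite cA.
    by rewrite orbT.
  rewrite label_sum_swap // psi_c.
  by move: bU; rewrite inE => /andP[_ /eqP->]; rewrite subrr addr0.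
by rewrite -eqB setU11 in cB'.
Qed.

(* Schrijver and Seymour's lower bound on the number of labels of the bases of
   the contraction [M / P], rearranged so that no subtraction occurs. *)
Lemma sum_rank_leq P : A :&: B \subset P -> P \subset B ->
  (\sum_(g <- G) rank M (P :|: U g)).+1
    <= #|` shifted_labels P| + #|B :\: P| + #|` G| * #|P|.
Proof.
move: {2}#|B :\: P| (leqnn #|B :\: P|) => n; elim: n P => [|n IHn] P.
  rewrite leqn0 cards_eq0 setD_eq0 => BP _ PB.
  have -> : P = B by apply/eqP; rewrite eqEsubset PB.
  (* With [P = B], label 0 pays for the successor, and every rank is at most [#|B|]. *)
  have lab0 : 0%R \in shifted_labels B.
    by apply/shifted_labelsP; exists B; rewrite subsetUr subrr.
  rewrite setDv cards0 addn0 -add1n leq_add //.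
    by rewrite cardfs_gt0; apply/fset0Pn; exists 0%R.
  rewrite mulnC -[#|` G|]sum1_size big_distrr /=.
  apply: leq_sum => g _; have [I [_ indI <-]] := rank_witness M (B :|: U g).
  by rewrite muln1 (basis_card_max bB).
move=> leBP CP PB; have [BP0|/set0Pn[e]] := eqVneq (B :\: P) set0.
  by apply: IHn => //; rewrite BP0 cards0.
rewrite inE => /andP[eP eB].
have PeB : e |: P \subset B by rewrite subUset sub1set eB.
have cardBP : #|B :\: P| = #|B :\: (e |: P)|.+1.
  rewrite (cardsD1 e (B :\: P)) inE eP eB add1n; congr _.+1.
  by apply: eq_card => x; rewrite !inE negb_or andbA.
have := IHn (e |: P); rewrite -ltnS -cardBP => /(_ leBP).
move=> /(_ (subset_trans CP (subsetUr _ _)) PeB).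
pose spans g := rank M (e |: (P :|: U g)) == rank M (P :|: U g).
(* The label changes available when [e] is exchanged; [g = psi e] gives 0. *)
pose W := [fset (g - psi e)%R | g in [fset g in G | spans g]]%fset.
have spansP T g : basis M T -> e |: P \subset T -> T \subset A :|: B -> spans g ->
    exists c, [/\ psi c = g, c \notin T :\ e, basis M (c |: T :\ e),
      P \subset c |: T :\ e & c |: T :\ e \subset A :|: B].
  move=> bT PeT TAB /eqP /(basis_exchange_span bT PeT eP)[c [cU cT bTc]].
  exists c; split=> //.
  - by move: cU; rewrite inE => /andP[_ /eqP].
  - apply/subsetP=> x xP; rewrite !inE; have -> : x != e by apply: contraNneq eP => <-.
    by rewrite (subsetP PeT) ?orbT // !inE xP orbT.
  - rewrite subUset sub1set (subset_trans (subD1set _ _) TAB) andbT.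
    by move: cU; rewrite !inE => /andP[/andP[]].
have leS : #|` shifted_labels (e |: P)| + #|` W| <= #|` shifted_labels P|.+1.
  apply: leq_trans (_ : #|` sumset (shifted_labels (e |: P)) W|.+1 <= _); last first.
    rewrite ltnS; apply/fsubset_leq_card/fsubsetP=> z.
    case/sumsetP=> x [w [/shifted_labelsP[T [bT PeT TAB ->]] + ->]].
    case/imfsetP=> g /=; rewrite !inE => /andP[_ sg] ->.
    have [c [psi_c cT bTc PTc TcAB]] := spansP T g bT PeT TAB sg.
    apply/shifted_labelsP; exists (c |: T :\ e); split=> //.
    rewrite label_sum_swap ?psi_c //; first by rewrite addrAC.
    by apply: (subsetP PeT); rewrite setU11.
  apply: Scherk.
  - by apply/shifted_labelsP; exists B; rewrite subsetUr subrr.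
  - apply/imfsetP; exists (psi e); last by rewrite subrr.
    have eU : e \in U (psi e).
      rewrite !inE eB orbT eqxx !andbT.
      by apply: contra eP => eA; apply: (subsetP CP); rewrite inE eA.
    rewrite !inE codom_f /spans /=; apply/eqP; congr rank.
    by apply/setUidPr; rewrite sub1set inE eU orbT.
  move=> x w /shifted_labelsP[T [bT PeT TAB ->]] /imfsetP[g /=].
  rewrite !inE => /andP[_ sg] -> sum0.
  have [c [psi_c cT bTc PTc TcAB]] := spansP T g bT PeT TAB sg.
  have eT : e \in T by apply: (subsetP PeT); rewrite setU11.
  (* The exchanged basis has the label of [B], so it is [B] and still contains [e]; this forces
     [c = e]. *)
  have eqB : c |: T :\ e = B.
    apply: isolated => //; first exact: subset_trans CP PTc.
    apply/eqP; rewrite label_sum_swap // psi_c -subr_eq0.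
    by move: sum0; rewrite addrAC => ->.
  have : e \in c |: T :\ e by rewrite eqB.
  by rewrite !inE eqxx orbF -psi_c => /eqP->; rewrite subrr.
have leW : \sum_(g <- G) spans g <= #|` W|.
  by rewrite card_imfset ?leq_sum_card_fset //; exact: addIr.
have sum_step : \sum_(g <- G) rank M (e |: P :|: U g) + \sum_(g <- G) spans g
    = \sum_(g <- G) rank M (P :|: U g) + #|` G|.
  rewrite -[#|` G|]sum1_size -!big_split /=; apply: eq_bigr => g _.
  by rewrite -setUA rankU1 addn1.
(* The 1 lost in [leS] is made up by the drop of [#|B :\: P|]. *)
rewrite [#|e |: P|]cardsU1 eP cardBP; nia.
Qed.

Lemma card_shifted_labels : #|A :\: B| < #|` shifted_labels (A :&: B)|.
Proof.
have := sum_rank_leq (subxx _) (subsetIr A B).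
(* Each [C :|: U g] with [C = A :&: B] is independent, and the [U g] partition the symmetric
   difference of [A] and [B]. *)
have -> : \sum_(g <- G) rank M (A :&: B :|: U g) =
    #|` G| * #|A :&: B| + #|(A :|: B) :\: (A :&: B)|.
  under eq_bigr => g _.
    rewrite rank_indep ?indep_color_class // cardsU.
    have -> : A :&: B :&: U g = set0.
      by apply/setP=> x; rewrite !inE; case: (x \in A); case: (x \in B).
    rewrite cards0 subn0.
    over.
  rewrite big_split /=; congr (_ + _).
    by rewrite big_const_seq count_predT iter_addn_0 mulnC.
  under eq_bigr => g _.
    rewrite -sum1_card.
    under eq_bigl => x do rewrite inE.
    rewrite big_mkcondr /=.
    over.
  rewrite exchange_big /= -sum1_card; apply: eq_bigr => x _.
  rewrite -big_mkcond sum1_count /=.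
  under eq_count => g do rewrite eq_sym.
  rewrite count_uniq_mem ?fset_uniq //.
  by rewrite !inE codom_f.
have -> : #|B :\: (A :&: B)| = #|A :\: B|.
  have := card_basis bA bB; rewrite -(cardsID B A) -(cardsID A B) setIC.
  by rewrite setDIr setDv setU0; lia.
have -> : #|(A :|: B) :\: (A :&: B)| = #|A :\: B| + #|A :\: B|.
  have := card_basis bA bB; rewrite -(cardsID B A) -(cardsID A B) (setIC B A).
  rewrite -(cardsID A ((A :|: B) :\: (A :&: B))).
  have -> : ((A :|: B) :\: (A :&: B)) :&: A = A :\: B.
    by apply/setP=> x; rewrite !inE; case: (x \in A); case: (x \in B).
  have -> : (A :|: B) :\: (A :&: B) :\: A = B :\: A.
    by apply/setP=> x; rewrite !inE; case: (x \in A); case: (x \in B).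
  by lia.
by lia.
Qed.

End Isolated.

(** * Avoiding basis closest to [A] *)

Theorem theorem4p4 (E : finType) (M : matroid E) (Gamma : zmodType)
  (psi : E -> Gamma) (F : {fset Gamma}) (hF : #|` F| <= 4)
  (hex : exists B : {set E}, basis M B /\ avoiding psi F B) :
  forall A : {set E}, basis M A ->
    exists B : {set E},
      [/\ basis M B, avoiding psi F B & #|A :\: B| <= #|` F| ].
Proof.
move=> A bA; have [B0 [bB0 avB0]] := hex.
have [|B /andP[bB avB] minB] :=
  @arg_minnP _ B0 (fun B => basis M B && avoiding psi F B) (fun B => #|A :\: B|).
  by rewrite bB0.
exists B; split=> //.
have labF T : basis M T -> A :&: B \subset T -> T \subset A :|: B -> T != B ->
    label_sum psi T \in F.
  move=> bT CT TAB neqTB; apply: contraT => avT.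
  (* Having the size of [B], [T] contains an element of [A :\: B], so an avoiding [T] would be
     closer to [A]. *)
  have := minB T; rewrite bT => /(_ avT); rewrite leqNgt => /negP[].
  apply: proper_card; apply/properP; split.
    apply/subsetP=> x; rewrite !inE => /andP[xT xA]; rewrite xA andbT.
    by apply: contra xT => xB; apply: (subsetP CT); rewrite inE xA.
  have /subsetPn[x xT xB] : ~~ (T \subset B).
    by apply: contra neqTB => TB; rewrite eqEcard TB (card_basis bT bB) /=.
  have := subsetP TAB x xT; rewrite inE (negPf xB) orbF => xA.
  by exists x; rewrite !inE ?xB ?xT.
have isoB T : basis M T -> A :&: B \subset T -> T \subset A :|: B ->
    label_sum psi T = label_sum psi B -> T = B.
  move=> bT CT TAB eqT; apply: contraTeq avB => /(labF T bT CT TAB).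
  by rewrite /avoiding -eqT => ->.
rewrite -ltnS; apply: leq_trans (card_shifted_labels bA bB isoB) _.
(* All labels in question lie in [F] together with the label of [B], which is outside [F]. *)
have <- : #|` (label_sum psi B |` F)%fset| = #|` F|.+1.
  by rewrite cardfsU1 -[_ \notin F]/(avoiding psi F B) avB.
have <- : #|` [fset (x - label_sum psi B)%R | x in label_sum psi B |` F]%fset|
    = #|` (label_sum psi B |` F)%fset|.
  by rewrite card_imfset //; exact: GRing.addIr.
apply/fsubset_leq_card/fsubsetP=> z /shifted_labelsP[T [bT CT TAB ->]].
apply/imfsetP; exists (label_sum psi T) => //=; rewrite !inE.
have [->|neqTB] := eqVneq T B; first by rewrite eqxx.
by rewrite labF ?orbT.
Qed.
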